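(* Let $\mathcal{S}^{(k)}$ be a constructing string generating a $k$-vertex connected threshold graph $\mathbb{G}_T^{(k)}$ with Laplacian matrix $\mathcal{L}_T^{(k)}$. Let $\bar s$ be the number of successions in $\mathcal{S}^{(k)}$, and let $\mathcal{S}^{(k_1)}\subseteq\mathcal{S}^{(k_2)}\subseteq\cdots\subseteq\mathcal{S}^{(k_{\bar s})}\subseteq\mathcal{S}^{(k)}$ be the essential substrings of $\mathcal{S}^{(k)}$. Let $B\in\{0,1\}^{k\times p}$ be a binary control matrix. Then $(\mathcal{L}_T^{(k)},B)$ is controllable if and only if the matrix $C^T(\mathcal{S}^{(k_i)})\,\hat B(\mathcal{S}^{(k_i)})$ has full row rank for each $i\in\{1,\dots,\bar s\}$, where $C(\mathcal{S}^{(k_i)})$ and $\hat B(\mathcal{S}^{(k_i)})$ are the local checking matrix and the local control matrix of $\mathcal{S}^{(k_i)}$.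
   Context: All graphs are simple (undirected, unweighted, no loops, no multiple edges) and connected. The Laplacian matrix is $\mathcal{L}=\mathcal{D}-\mathcal{A}$ (diagonal degree matrix minus adjacency matrix). For a real matrix $B\in\mathbb{R}^{k\times p}$, $(\mathcal{L},B)$ denotes the linear time-invariant control system $\dot{\boldsymbol x}=-\mathcal{L}\boldsymbol x+B\boldsymbol u(t)$, and controllability is meant in the usual sense (equivalently, $\mathcal{L}$ has no eigenvector in the null space of $B^T$). $B$ is binary if all its entries are in $\{0,1\}$. Constructing string: a threshold graph is built from one isolated vertex by adding vertices one at a time, each new vertex being isolated (union) or adjacent to all existing vertices (join). The construction of a $k$-vertex threshold graph is encoded by $\mathcal{S}^{(k)}=(s_1,\dots,s_{k-1})$, where $s_i=1$ if the $(i+1)$th vertex is added by join and $s_i=0$ if by union. For a connected graph the string ends with $1$ (here $k\ge2$). Vertex ordering: during construction vertices are placed on a line, a vertex added by join being placed leftmost and a vertex added by union being placed rightmost. Vertices are numbered $1,\dots,k$ from left to right, and the rows of $\mathcal{L}_T^{(k)}$ and of $B$ are indexed accordingly (degrees are then nonincreasing). The same convention is used for the threshold graph generated by any substring. Substring: a substring $\mathcal{S}$ of $\mathcal{S}^{(k)}$ is an initial segment; $|\mathcal{S}|$ is its length, and it generates the threshold graph $\mathbb{G}_T^{(|\mathcal{S}|+1)}$ on the first $|\mathcal{S}|+1$ vertices added in the construction of $\mathbb{G}_T^{(k)}$. Succession: a succession of $s\in\{0,1\}$ in $(s_1,\dots,s_{k-1})$ is a block $(s_i,\dots,s_j)$ with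 $s_i=\cdots=s_j=s$, where $s_{i-1}$ and $s_{j+1}$ are each either undefined or different from $s$, and where $j\ge i$ if $i=1$ and $j>i$ if $i>1$. (So: the first maximal run, of any length, and every other maximal run of length at least $2$.) Essential substrings: for $i\in\{1,\dots,\bar s\}$, $\mathcal{S}^{(k_i)}$ is the shortest substring (initial segment) of $\mathcal{S}^{(k)}$ that contains the first $i$ successions of $\mathcal{S}^{(k)}$ and ends with $1$. Thus its terminal $1$ is the final entry of the $i$th succession if that is a succession of $1$, and is the $1$ immediately following the $i$th succession if that is a succession of $0$. Local control matrix: $\hat B(\mathcal{S})\in\mathbb{R}^{(|\mathcal{S}|+1)\times p}$ is the submatrix of $B$ formed by the rows corresponding to the vertices of $\mathbb{G}_T^{(|\mathcal{S}|+1)}$, kept in left-to-right order. Local checking matrix: let $m$ be the number of entries of the last succession in $\mathcal{S}$. Then $C(\mathcal{S})\in\mathbb{R}^{(|\mathcal{S}|+1)\times m}$ is defined as follows, where $\boldsymbol e_i$ and $\boldsymbol e_{-i}$ denote the $i$th and the $i$th-to-last columns of the identity matrix of order $|\mathcal{S}|+1$. - If the last succession of $\mathcal{S}$ is a succession of $1$: for $j=1,\dots,m-1$, the $j$th column is $\boldsymbol e_1-\boldsymbol e_{j+1}$. The last column is $\boldsymbol e_1-\boldsymbol e_{m+1}$ if $\mathcal{S}$ has only one succession, and is $(|\mathcal{S}|+1-m)\boldsymbol e_1-\sum_{j=m+1}^{|\mathcal{S}|+1}\boldsymbol e_j$ otherwise. - If the last succession of $\mathcal{S}$ is a succession of $0$: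 for $j=1,\dots,m-1$, the $j$th column is $\boldsymbol e_{-1}-\boldsymbol e_{-(j+1)}$. The last column is $\boldsymbol e_{-1}-\boldsymbol e_{-(m+1)}$ if $\mathcal{S}$ has only one succession, and is $(|\mathcal{S}|-m)\boldsymbol e_{-1}-\sum_{j=m+1}^{|\mathcal{S}|}\boldsymbol e_{-j}$ otherwise. *)

(* Defs.v *)
From HB Require Import structures.
From mathcomp Require Import all_boot all_order all_algebra.
From mathcomp Require Import all_classical all_reals all_analysis.

Set Implicit Arguments.
Unset Strict Implicit.
Unset Printing Implicit Defensive.

Import Order.TTheory GRing.Theory Num.Theory.
Import numFieldNormedType.Exports.

Local Open Scope classical_set_scope.
Local Open Scope ring_scope.

(** * Controllability *)

(** [x] is a trajectory on [[0, T]] of [x' = A x + B u]; everything is stated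
    entrywise, and values outside [[0, T]] are irrelevant. *)
Definition trajectory (R : realType) (n p : nat) (A : 'M[R]_n)
    (B : 'M[R]_(n, p)) (T : R) (u : R -> 'cV[R]_p) (x : R -> 'cV[R]_n) : Prop :=
  [/\ forall j : 'I_p, {within `[0, T], continuous (fun t => u t j 0)},
      forall i : 'I_n, {within `[0, T], continuous (fun t => x t i 0)} &
      forall (i : 'I_n) (t : R), 0 < t < T ->
        is_derive t (1 : R) (fun r => x r i 0) ((A *m x t + B *m u t) i 0)].

Definition controllable (R : realType) (n p : nat) (A : 'M[R]_n)
    (B : 'M[R]_(n, p)) : Prop :=
  forall x0 x1 : 'cV[R]_n,
    exists (T : R) (u : R -> 'cV[R]_p) (x : R -> 'cV[R]_n),
      [/\ 0 < T, trajectory A B T u x, x 0 = x0 & x T = x1].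

(** * Graphs on ['I_n], given by their adjacency relation *)

Definition adjacency (R : realType) (n : nat) (e : rel 'I_n) : 'M[R]_n :=
  \matrix_(i, j) (e i j)%:R.

Definition laplacian (R : realType) (n : nat) (e : rel 'I_n) : 'M[R]_n :=
  diag_mx (\row_i #|[pred j | e i j]|%:R) - adjacency R e.

Definition connected_graph (n : nat) (e : rel 'I_n) : Prop :=
  forall i j : 'I_n, connect e i j.

(** * Threshold graphs

    A constructing string is a [seq bool] ([true] for a join, [false] for a
    union).  A vertex is named in two ways: by its birth date (the initial
    vertex is [0], the one added by the [a]th letter, counted from 1, is [a]),
    and by its position on the line, counted from the left.  Matrices are
    indexed by positions. *)

Definition place (l : seq nat) (b : bool) : seq nat :=
  if b then size l :: l else rcons l (size l).

(** The birth dates of the vertices, read from left to right. *)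
Definition line (s : seq bool) : seq nat := foldl place [:: 0%N] s.

(** Two distinct vertices are adjacent iff the younger one came by a join. *)
Definition birth_adj (s : seq bool) (a b : nat) : bool :=
  (a != b) && nth false s (maxn a b).-1.

Definition threshold (s : seq bool) : rel 'I_(size s).+1 :=
  fun i j => birth_adj s (nth 0%N (line s) i) (nth 0%N (line s) j).
Arguments threshold s : clear implicits.

(** * Successions and essential substrings *)

(** The block of letters from [ij.1] to [ij.2], both included, counted from
    0. *)
Definition is_succession (s : seq bool) (ij : nat * nat) : bool :=
  let: (i, j) := ij in
  let c := nth false s i in
  [&& (i <= j < size s)%N,
      all (fun l => nth false s l == c) (iota i (j.+1 - i)),
      (i == 0%N) || (nth false s i.-1 != c),
      (j.+1 == size s) || (nth false s j.+1 != c) &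
      (i == 0%N) || (i < j)%N].

(** All the successions, in order of appearance. *)
Definition successions (s : seq bool) : seq (nat * nat) :=
  [seq ij <- [seq (i, j) | i <- iota 0 (size s), j <- iota 0 (size s)]
         | is_succession s ij].

(** [find] over [0, 1, 2, ...] returns the least suitable length. *)
Definition essential (s : seq bool) (i : nat) : seq bool :=
  take (find (fun n => last false (take n s) &&
                       all (fun ij => ij.2 < n)%N (take i (successions s)))
             (iota 0 (size s).+1)) s.

(** * Local control and checking matrices *)

(** The [i]th vertex on the line of [t] is looked up, by its birth date, on the
    line of [s]. *)
Definition local_control (R : realType) (s t : seq bool) (p : nat)
    (B : 'M[R]_((size s).+1, p)) : 'M[R]_((size t).+1, p) :=
  \matrix_(i, j) B (inord (index (nth 0%N (line t) i) (line s))) j.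

Definition last_succession (t : seq bool) : nat * nat :=
  last (0%N, 0%N) (successions t).

Definition last_length (t : seq bool) : nat :=
  ((last_succession t).2.+1 - (last_succession t).1)%N.

Definition last_letter (t : seq bool) : bool :=
  nth false t (last_succession t).1.

(** The [i]th and the [i]th-to-last columns of the identity, [i] counted from
    1. *)
Definition evec (R : realType) (n i : nat) : 'cV[R]_n :=
  \col_(r < n) (r.+1 == i)%:R.

Definition evec_rev (R : realType) (n i : nat) : 'cV[R]_n :=
  \col_(r < n) (r + i == n)%N%:R.

(** [j] is counted from 1. *)
Definition checking_col (R : realType) (t : seq bool) (j : nat) :
    'cV[R]_(size t).+1 :=
  let e := evec R (size t).+1 in
  let e' := evec_rev R (size t).+1 in
  let m := last_length t in
  let only_one := size (successions t) == 1%N in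
  if last_letter t then
    if (j < m)%N then e 1%N - e j.+1
    else if only_one then e 1%N - e m.+1
    else ((size t).+1 - m)%N%:R *: e 1%N
         - \sum_(m.+1 <= l < (size t).+2) e l
  else
    if (j < m)%N then e' 1%N - e' j.+1
    else if only_one then e' 1%N - e' m.+1
    else (size t - m)%N%:R *: e' 1%N
         - \sum_(m.+1 <= l < (size t).+1) e' l.

Definition checking (R : realType) (t : seq bool) :
    'M[R]_((size t).+1, last_length t) :=
  \matrix_(r, c) checking_col R t c.+1 r 0.

(* Main.v *)
Require Import Defs.
From mathcomp Require Import all_boot all_order all_algebra.
From mathcomp Require Import all_classical all_reals all_analysis.
From mathcomp Require Import ring zify.

Import Order.TTheory GRing.Theory Num.Theory.
Import numFieldNormedType.Exports.

Local Open Scope ring_scope.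

(** The Laplacian of a threshold graph has an explicit orthogonal eigenbasis.
    Name the vertices by their birth dates.  For every birth date [a > 0], the
    vector [a e_a - sum_(b < a) e_b] is an eigenvector whatever is built later
    ([threshold_vec]): the vertices born before [a] all see [a] in the same way,
    and every vertex born after [a] sees all of [0, ..., a] in the same way, so
    it only shifts the eigenvalue by one if it is joined.  The constant vector
    completes the basis; its eigenvalue [0] is simple because the graph is
    connected, that is, because the string ends with a join.  Two of the other
    vectors share their eigenvalue exactly when the letters that bring their
    births and all letters in between are equal ([block_eigenvalue_inj]).  So
    the other eigenspaces belong to the maximal runs of equal letters: for a run
    that brings the births [i+1, ..., j+1] it is the space of the vectors
    supported on [0, ..., j+1], constant on [0, ..., i] and of sum zero
    ([block_vector]).
    Up to zero entries, the columns of the checking matrix of an essential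
    substring form a basis of this space for the corresponding succession
    ([checking_vec_coord]).  The full row rank of the product with the local
    control matrix therefore says that no nonzero vector of this one eigenspace
    is annihilated by [B] ([row_free_checkingP]).

    By the eigenvector test, controllability means that no eigenvector
    at all is annihilated by [B].  What remains are the eigenspaces that are not
    tested: the constants, and the runs of length one that do not start the
    string.  Here binarity is used.  If a nonzero vector of one of these is
    annihilated, then in each column of [B] the mean of some entries, all in
    [{0, 1}], is itself [0] or [1]; hence these entries are all equal
    ([binary_mean]).  They include the entries met by the first succession, and
    there a constant column is orthogonal to every column of the checking
    matrix, so that the first rank condition fails
    ([first_check_not_constant]).

    The eigenvector test itself is proved for trajectories.  If [q A = mu q] and
    [q B = 0], then [exp (- mu t) q x(t)] is constant along every trajectory, so
    the state cannot be steered freely ([controllable_hautus]).  Conversely, in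
    a basis of eigenvectors the system splits into modes [z' = l z + b u], with a
    row vector [b] for each of them; for distinct [l] a single scalar polynomial input drives all the modes
    [z' = l z + u] simultaneously between prescribed values
    ([parallel_modes_steering]), and the test provides for each eigenvalue the
    weights with which its modes have to be driven ([modal_input]). *)

Set Implicit Arguments.
Unset Strict Implicit.

(** * The eigenvector test for controllability *)

Local Open Scope classical_set_scope.
Local Open Scope ring_scope.

(** The Popov-Belevitch-Hautus test, in terms of left eigenvectors. *)
Definition hautus {F : fieldType} {n p : nat} (A : 'M[F]_n) (B : 'M[F]_(n, p)) :=
  forall (mu : F) (q : 'rV[F]_n), q *m A = mu *: q -> q *m B = 0 -> q = 0.

Lemma within_continuous_sum {R : realType} (D : set R) (n : nat)
    (f : 'I_n -> R -> R) :
  (forall i, {within D, continuous (f i)}) ->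
  {within D, continuous (fun t => \sum_i f i t)}.
Proof.
move=> fc; rewrite (_ : (fun t => _) = \sum_i f i); last first.
  by apply/funext => t; rewrite fct_sumE.
elim/big_ind: _ => [|f1 f2 c1 c2|i _]; last exact: fc.
- by move=> t; exact: cvg_cst.
- by move=> t; apply: cvgD; [exact: c1|exact: c2].
Qed.

(** The derivative of [q x(t)] is [mu q x(t)], so that [exp (- mu t) q x(t)] is
    constant: from the state [0] the state [q^T] cannot be reached. *)
Lemma controllable_hautus {R : realType} {n p : nat} (A : 'M[R]_n)
    (B : 'M[R]_(n, p)) :
  controllable A B -> hautus A B.
Proof.
move=> ctrl mu q qA qB.
have [T [u [x [T_gt0 [_ xc dx] x0 xT]]]] := ctrl 0 q^T.
pose y t := \sum_i q 0 i * x t i 0.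
have yE t : y t = (q *m x t) 0 0 by rewrite mxE.
have dy t : 0 < t < T -> is_derive t (1 : R) y (mu * y t).
  move=> tT.
  have -> : y = \sum_i (q 0 i \*: (fun r => x r i 0)).
    by apply/funext => r; rewrite fct_sumE.
  apply: trigger_derive.
    by apply: is_derive_sum => i; apply: is_deriveZ; exact: dx.
  transitivity ((q *m (A *m x t + B *m u t)) 0 0); first by rewrite mxE.
  rewrite mulmxDr !mulmxA qA qB mul0mx addr0 -scalemxAl mxE -yE.
  by rewrite fct_sumE.
pose g t := expR (- mu * t) * y t.
have dg t : t \in `]0, T[ -> is_derive t (1 : R) g 0.
  rewrite in_itv /= => /dy dyt.
  have -> : g = (expR \o ( *%R (- mu))) * y by [].
  have dlin : is_derive t (1 : R) ( *%R (- mu)) (- mu * 1).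
    exact: (@is_deriveZ _ _ _ id).
  have dexp := is_derive1_comp (is_derive_expR (- mu * t)) dlin.
  have dprod := is_deriveM dexp dyt.
  apply: (trigger_derive dprod).
  by rewrite /GRing.scale /=; ring.
have yc : {within `[0, T]%classic, continuous y}.
  apply: within_continuous_sum => i t.
  by apply: cvgM; [exact: cvg_cst|exact: xc].
have gc : {within `[0, T]%classic, continuous g}.
  move=> t; apply: cvgM; last exact: yc.
  apply: continuous_subspaceT => r.
  apply: (@continuous_comp _ _ _ (fun r => - mu * r)).
    exact: mulrl_continuous.
  exact: continuous_expR.
have [c _] := MVT T_gt0 dg gc.
rewrite mul0r /g !yE x0 mulmx0 [in X in _ - X]mxE mulr0 subr0 xT => /eqP.
rewrite mulf_eq0 gt_eqF ?expR_gt0 //= => /eqP qq.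
have : \sum_i q 0 i ^+ 2 = 0.
  by apply: etrans qq; rewrite mxE; apply: eq_bigr => i _; rewrite mxE expr2.
move/eqP; rewrite psumr_eq0 => [/allP qi|i _]; last exact: sqr_ge0.
apply/rowP => i; rewrite mxE; apply/eqP; rewrite -sqrf_eq0.
by apply: qi; rewrite mem_index_enum.
Qed.

Local Close Scope classical_set_scope.

Lemma derivn_XsubC_expM {F : numFieldType} (c : F) (N k : nat) (v : {poly F}) :
  (k < N)%N -> (('X - c%:P) ^+ N * v)^`(k).[c] = 0.
Proof.
elim: k N v => [|k IHk] [|N] v // kN.
  by rewrite derivn0 hornerM horner_exp hornerXsubC subrr expr0n mul0r.
have dE : (('X - c%:P) ^+ N.+1 * v)^`() =
    ('X - c%:P) ^+ N * (N.+1%:R * v + ('X - c%:P) * v^`()).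
  by rewrite derivM deriv_exp derivXsubC mul1r /= -mulr_natr exprS; ring.
by rewrite derivSn dE IHk.
Qed.

Lemma derivn_comp_XsubC {F : numFieldType} (c : F) (k : nat) (v : {poly F}) :
  (v \Po ('X - c%:P))^`(k) = v^`(k) \Po ('X - c%:P).
Proof.
by elim: k v => [|k IHk] v //; rewrite !derivSn deriv_comp derivXsubC mulr1.
Qed.

(** A Taylor polynomial at [c]. *)
Lemma jet_interpolation {F : numFieldType} (c : F) (N : nat) (a : nat -> F) :
  exists v : {poly F}, forall k, (k < N)%N -> v^`(k).[c] = a k.
Proof.
exists ((\poly_(k < N) (a k / k`!%:R)) \Po ('X - c%:P)) => k kN.
rewrite derivn_comp_XsubC horner_comp !hornerE subrr horner_coef0.
by rewrite coef_derivn addn0 coef_poly kN ffactnn -(mulr_natr (_ / _)) divfK //.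
Qed.

(** Hermite interpolation at two points, by the Chinese remainder theorem for
    the coprime polynomials ['X ^ N] and [('X - 1) ^ N]. *)
Lemma two_point_jet_interpolation {F : numFieldType} (N : nat) (a b : nat -> F) :
  exists v : {poly F}, forall k, (k < N)%N ->
    v^`(k).[0] = a k /\ v^`(k).[1] = b k.
Proof.
have [va vaE] := jet_interpolation 0 N a.
have [vb vbE] := jet_interpolation 1 N b.
pose P0 : {poly F} := ('X - 0%:P) ^+ N; pose P1 : {poly F} := ('X - 1%:P) ^+ N.
have /Bezout_eq1_coprimepP[[u w] /= uw] : coprimep P0 P1.
  apply/coprimep_expl/coprimep_expr.
  by rewrite coprimep_XsubC root_XsubC oner_eq0.
exists (vb * (u * P0) + va * (w * P1)) => k kN; split.
  have -> : vb * (u * P0) + va * (w * P1) = va + P0 * (u * (vb - va)).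
    by rewrite -[X in _ = X + _]mulr1 -uw; ring.
  by rewrite derivnD hornerD vaE // derivn_XsubC_expM // addr0.
have -> : vb * (u * P0) + va * (w * P1) = vb + P1 * (w * (va - vb)).
  by rewrite -[X in _ = X + _]mulr1 -uw; ring.
by rewrite derivnD hornerD vbE // derivn_XsubC_expM // addr0.
Qed.

(** The derivatives at a point of a function [v] with value [c] there, when the
    derivatives of [v' - mu v] at that point are given by [a]. *)
Fixpoint preimage_jet {F : numFieldType} (mu c : F) (a : nat -> F) (k : nat) : F :=
  if k is k'.+1 then a k' + mu * preimage_jet mu c a k' else c.

(** A common input [u] drives the scalar modes [z' = l z + u], one for each [l]
    in [ls], between prescribed values at times [0] and [1].  Prescribing also
    the jets of [u] at both ends makes an induction on [ls] possible: to add the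
    mode [mu], take an input [v] and modes [w l] for the others.  With the
    input [u := v' - mu v], the function [v] itself is a mode for [mu], and
    [v + (l - mu) w l] is a mode for [l]; their end values, and the jets of
    [u], prescribe those of [v] and [w l]. *)
Lemma parallel_modes_steering {F : numFieldType} (ls : seq F) (N : nat)
    (a b : nat -> F) (z0 z1 : F -> F) :
  uniq ls ->
  exists (u : {poly F}) (z : F -> {poly F}),
    (forall k, (k < N)%N -> u^`(k).[0] = a k /\ u^`(k).[1] = b k) /\
    {in ls, forall l, [/\ (z l)^`() = l *: z l + u, (z l).[0] = z0 l &
                          (z l).[1] = z1 l]}.
Proof.
elim: ls N a b z0 z1 => [|mu ls IHls] N a b z0 z1 /=.
  move=> _; have [u uE] := two_point_jet_interpolation N a b.
  by exists u, (fun=> 0); split.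
case/andP=> mu_ls /IHls{}IHls.
have [v [w [vE wE]]] := IHls N.+1 (preimage_jet mu (z0 mu) a)
  (preimage_jet mu (z1 mu) b) (fun l => (z0 l - z0 mu) / (l - mu))
  (fun l => (z1 l - z1 mu) / (l - mu)).
have [v0 v1] := vE 0%N isT.
exists (v^`() - mu *: v).
exists (fun l => if l == mu then v else v + (l - mu) *: w l); split=> [k kN|l].
  have [k0 k1] := vE k (ltnW kN : (k < N.+1)%N).
  have [/= k0' k1'] := vE k.+1 kN.
  rewrite derivnB derivnZ -derivSn !hornerE k0 k1 k0' k1'.
  by split; rewrite addrK.
rewrite inE; case: eqVneq => [-> _|lmu /= lls].
  by split; rewrite // addrC subrK.
have [dw w0 w1] := wE l lls.
have lmu0 : l - mu != 0 by rewrite subr_eq0.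
split; last 2 first.
- by rewrite !hornerE w0 -[v.[0]]/(v^`(0).[0]) v0 /= mulrC divfK // addrC subrK.
- by rewrite !hornerE w1 -[v.[1]]/(v^`(0).[1]) v1 /= mulrC divfK // addrC subrK.
rewrite derivD derivZ dw -!mul_polyC polyCB; ring.
Qed.

(** Among the rows of [V B] that belong to the eigenvalue [l], every linear
    relation gives a left eigenvector annihilated by [B]; by the test these rows
    are thus independent, and a linear system with them as matrix is solvable
    for every right-hand side. *)
Lemma modal_input {F : fieldType} {n p : nat} (A V : 'M[F]_n) (B : 'M[F]_(n, p))
    (d : 'rV[F]_n) (l : F) (y : 'cV[F]_n) :
  V \in unitmx -> V *m A = diag_mx d *m V -> hautus A B ->
  exists w : 'cV[F]_p, forall i, d 0 i = l -> (V *m B *m w) i 0 = y i 0.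
Proof.
move=> Vu VA AB.
(* the projection onto the coordinates of eigenvalue l *)
pose P := diag_mx (\row_i (d 0 i == l)%:R : 'rV[F]_n).
have PD : P *m diag_mx d = l *: P.
  apply/matrixP => i j; rewrite mul_diag_mx !mxE.
  by case: eqVneq => [->|_]; rewrite ?mul1r ?mul0r ?mul0rn ?mulr0 // mulrnAr mulr1.
have [M MT] : exists M : 'M[F]_(p, n), (M^T = P *m V *m B)%R.
  by exists (P *m V *m B)^T; rewrite trmxK.
have : (y^T *m P <= M)%MS.
  rewrite submxE.
  move: (cokermx M) (mulmx_coker M) => K MK.
  suff PK : P *m K = 0 by rewrite -mulmxA PK mulmx0.
  apply: trmx_inj; rewrite trmx0 trmx_mul tr_diag_mx.
  apply/row_matrixP => i; rewrite row0.
  have := AB l (row i (K^T *m P *m V)).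
  rewrite -!row_mul -(mulmxA _ V) VA mulmxA -(mulmxA _ P) PD.
  rewrite -!(scalemxAr, scalemxAl) linearZ /= => /(_ erefl).
  have -> : K^T *m P *m V *m B = 0.
    by rewrite -!mulmxA (mulmxA P) -MT -trmx_mul MK trmx0.
  rewrite row0 => /(_ erefl) e.
  by rewrite -[LHS](mulmxK Vu) -row_mul e mul0mx.
case/submxP => w wE; exists w^T => i di.
have -> : y i 0 = (y^T *m P) 0 i by rewrite mul_mx_diag !mxE di eqxx mulr1.
have -> : y^T *m P = (P *m (V *m B *m w^T))^T.
  by rewrite !mulmxA -MT -trmx_mul trmxK.
by rewrite mxE [RHS]mxE mul_diag_mx [in RHS]mxE [X in X * _]mxE di eqxx mul1r mxE.
Qed.

Local Open Scope classical_set_scope.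
Local Open Scope ring_scope.

(** The input [u] and the modes [z] of [parallel_modes_steering] are chosen
    separately for each component of the control.  Then the combinations of the
    [z c l] with the coefficients of row [i] of [V B], where [l] is the [i]th
    eigenvalue, are the coordinates of a trajectory in the basis [V]. *)
Lemma hautus_controllable {R : realType} {n p : nat} (A V : 'M[R]_n)
    (B : 'M[R]_(n, p)) (d : 'rV[R]_n) :
  V \in unitmx -> V *m A = diag_mx d *m V -> hautus A B -> controllable A B.
Proof.
move=> Vu VA AB x0 x1.
(* W is opaque so that mxE does not expand its entries *)
have [W WE] : exists W, W = V *m B by exists (V *m B).
have [w0 w0E] := choice (fun l => modal_input l (V *m x0) Vu VA AB).
have [w1 w1E] := choice (fun l => modal_input l (V *m x1) Vu VA AB).
pose ls := undup [seq d 0 i | i <- enum 'I_n].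
have dls i : d 0 i \in ls by rewrite mem_undup map_f ?mem_enum.
have [u /choice[z zE]] := choice (fun c : 'I_p =>
  parallel_modes_steering (ls := ls) 0 (fun=> 0) (fun=> 0) (fun l => w0 l c 0)
  (fun l => w1 l c 0) (undup_uniq _)).
have zd c i := (zE c).2 _ (dls i).
pose up t := \col_c (u c).[t].
pose yp i := \sum_c W i c *: z c (d 0 i).
pose y t := \col_i (yp i).[t].
pose xp i := \sum_j invmx V i j *: yp j.
pose x t := \col_i (xp i).[t].
have xE t : x t = invmx V *m y t.
  apply/colP => i; rewrite !mxE /xp horner_sum; apply: eq_bigr => j _.
  by rewrite hornerZ mxE.
have endpoint t (xt : 'cV_n) (wt : R -> 'cV_p) :
    (forall l i, d 0 i = l -> (W *m wt l) i 0 = (V *m xt) i 0) ->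
    (forall c i, (z c (d 0 i)).[t] = wt (d 0 i) c 0) -> x t = xt.
  move=> wtE zt; rewrite xE -[RHS](mulKmx Vu); congr (_ *m _); apply/colP => i.
  rewrite -(wtE _ _ erefl) !mxE horner_sum; apply: eq_bigr => c _.
  by rewrite hornerZ zt.
exists 1, up, x; split; first exact: ltr01; last 2 first.
- by apply: (endpoint _ _ w0) => [l i|c i]; [rewrite WE; exact: w0E|]; case: (zd c i).
- by apply: (endpoint _ _ w1) => [l i|c i]; [rewrite WE; exact: w1E|]; case: (zd c i).
split=> [c|i|i t _].
- rewrite (_ : (fun t => _) = horner (u c)); last by apply/funext => t; rewrite mxE.
  by apply: continuous_subspaceT; exact: continuous_horner.
- rewrite (_ : (fun t => _) = horner (xp i)); last by apply/funext => t; rewrite mxE.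
  by apply: continuous_subspaceT; exact: continuous_horner.
rewrite (_ : (fun t => _) = horner (xp i)); last by apply/funext => r; rewrite mxE.
have dxp := is_derive_poly (xp i) t.
apply: (trigger_derive dxp).
have dyp j : (yp j)^`().[t] = (diag_mx d *m y t + W *m up t) j 0.
  rewrite mxE mul_diag_mx !mxE raddf_sum !horner_sum mulr_sumr -big_split /=.
  apply: eq_bigr => c _; have [dz _ _] := zd c j.
  by rewrite derivZ dz !(hornerZ, hornerD) mxE; ring.
have -> : A *m x t + B *m up t = invmx V *m (diag_mx d *m y t + W *m up t).
  rewrite mulmxDr WE !mulmxA mulVmx // mul1mx; congr (_ + _).
  rewrite xE mulmxA -[y t in RHS](mulKVmx Vu) !mulmxA -(mulmxA _ _ V) -VA.
  by rewrite mulmxA mulVmx // mul1mx.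
rewrite mxE raddf_sum horner_sum; apply: eq_bigr => j _.
by rewrite /= derivZ hornerZ dyp.
Qed.

Local Close Scope classical_set_scope.

(** * The line of a threshold graph *)

Lemma line_rcons (s : seq bool) (b : bool) : line (rcons s b) = place (line s) b.
Proof. by rewrite /line foldl_rcons. Qed.

Lemma perm_line (s : seq bool) : perm_eq (line s) (iota 0 (size s).+1).
Proof.
elim/last_ind: s => [|s b IHs] //.
have size_l : size (line s) = (size s).+1 by rewrite (perm_size IHs) size_iota.
rewrite line_rcons size_rcons -[in iota _ _]addn1 iotaD cats1 add0n.
have perm_l : perm_eq (rcons (line s) (size s).+1)
    (rcons (iota 0 (size s).+1) (size s).+1).
  by rewrite -!cats1 perm_cat2r.
by rewrite /place size_l; case: b => //; rewrite -perm_rcons.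
Qed.

Lemma size_line (s : seq bool) : size (line s) = (size s).+1.
Proof. by rewrite (perm_size (perm_line s)) size_iota. Qed.

Lemma mem_line (s : seq bool) (b : nat) : (b \in line s) = (b <= size s)%N.
Proof. by rewrite (perm_mem (perm_line s)) mem_iota. Qed.

Lemma line_uniq (s : seq bool) : uniq (line s).
Proof. by rewrite (perm_uniq (perm_line s)) iota_uniq. Qed.

Lemma birth_le (s : seq bool) (r : nat) :
  (r <= size s)%N -> (nth 0%N (line s) r <= size s)%N.
Proof. by move=> rs; rewrite -mem_line mem_nth // size_line. Qed.

(** The line is a permutation of the birth dates. *)
Lemma sum_line {V : nmodType} (s : seq bool) (F : nat -> V) :
  \sum_(r < (size s).+1) F (nth 0%N (line s) r) = \sum_(0 <= b < (size s).+1) F b.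
Proof.
rewrite -[LHS](big_mkord predT (fun r => F (nth 0%N (line s) r))) -size_line.
by rewrite -(big_nth 0%N predT) (perm_big _ (perm_line s)) /index_iota subn0 size_line.
Qed.

Lemma iota_rcons (a m : nat) : iota a m.+1 = iota a m ++ [:: (a + m)%N].
Proof. by rewrite -addn1 iotaD. Qed.

Lemma line_cat_nseq (s : seq bool) (b : bool) (m : nat) :
  line (s ++ nseq m b) =
  if b then rev (iota (size s).+1 m) ++ line s else line s ++ iota (size s).+1 m.
Proof.
elim: m => [|m IHm]; first by case: b; rewrite !cats0.
have -> : nseq m.+1 b = rcons (nseq m b) b by rewrite -cats1 -[m.+1]addn1 nseqD.
rewrite -rcons_cat line_rcons IHm /place iota_rcons; case: b {IHm}.
  by rewrite rev_cat size_cat size_rev size_iota size_line addnC.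
by rewrite size_cat size_iota size_line -cats1 -catA.
Qed.

Definition homogeneous (s : seq bool) (i j : nat) :=
  forall l, (i <= l <= j)%N -> nth false s l = nth false s i.

Lemma homogeneous_take (s : seq bool) (i j : nat) :
  (i <= j < size s)%N -> homogeneous s i j ->
  take j.+1 s = take i s ++ nseq (j.+1 - i) (nth false s i).
Proof.
move=> /andP[ij js] hs.
have sz : size (take i s) = i by rewrite size_takel; lia.
apply: (@eq_from_nth _ false).
  by rewrite size_cat sz size_nseq size_takel; lia.
move=> l; rewrite size_takel // => lj.
rewrite nth_take // nth_cat sz; case: ltnP => li; first by rewrite nth_take.
by rewrite nth_nseq (_ : (l - i < j.+1 - i)%N); [apply: hs|]; lia.
Qed.

(** Each join of a final run [i..j] is placed to the left of all the others, so
    that the births [j+1, ..., i+1] come first, in decreasing order. *)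
Lemma line_final_joins (t : seq bool) (i j r : nat) :
  (i <= j)%N -> size t = j.+1 -> homogeneous t i j -> nth false t i = true ->
  (r <= j.+1)%N ->
  if (r < j.+1 - i)%N then nth 0%N (line t) r = (j.+1 - r)%N
  else (nth 0%N (line t) r <= i)%N.
Proof.
move=> ij st hs ti rj.
have ti_size : size (take i t) = i by rewrite size_takel; lia.
have := @homogeneous_take t i j; rewrite ti take_oversize ?st //.
move=> -> //; last by lia.
rewrite line_cat_nseq nth_cat size_rev size_iota ti_size; case: ltnP => ri.
  by rewrite nth_rev ?size_iota // nth_iota; lia.
rewrite -[X in (_ <= X)%N]ti_size birth_le // ti_size; lia.
Qed.

(** Each union of the run [i..j] is placed to the right of all the others, so
    that the births [i+1, ..., j+1] come last, in increasing order; the final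
    join takes the leftmost position and shifts the others by one. *)
Lemma line_final_unions (t : seq bool) (i j r : nat) :
  (i <= j)%N -> size t = j.+2 -> homogeneous t i j -> nth false t i = false ->
  nth false t j.+1 = true -> (r <= j.+2)%N ->
  if (r == 0)%N then nth 0%N (line t) r = j.+2 else
  if (i.+1 < r)%N then nth 0%N (line t) r = r.-1
  else (nth 0%N (line t) r <= i)%N.
Proof.
move=> ij st hs ti tj rj.
have ti_size : size (take i t) = i by rewrite size_takel; lia.
have -> : t = rcons (take i t ++ nseq (j.+1 - i) false) true.
  rewrite -ti -homogeneous_take ?st //; last by lia.
  by rewrite -tj -take_nth ?st // take_oversize // st.
rewrite line_rcons line_cat_nseq /= size_cat size_iota size_line ti_size.
case: r rj => [|r] rj /=; first by lia.
rewrite nth_cat size_line ti_size; case: (ltnP i.+1 r.+1) => ri.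
  by rewrite nth_iota; lia.
rewrite -[X in (_ <= X)%N]ti_size birth_le // ti_size; lia.
Qed.

(** * Successions and essential substrings *)

Lemma successionP (s : seq bool) (i j : nat) :
  reflect [/\ (i <= j < size s)%N, homogeneous s i j,
    (0 < i)%N -> nth false s i.-1 <> nth false s i,
    (j.+1 < size s)%N -> nth false s j.+1 <> nth false s i &
    (0 < i)%N -> (i < j)%N]
  (is_succession s (i, j)).
Proof.
apply: (iffP idP) => [/and5P[ij /allP hs si sj ij']|[ij hs si sj ij']].
  split=> //.
  - by move=> l lij; apply/eqP/hs; rewrite mem_iota; lia.
  - by case: i si {ij hs sj ij'} => // i /eqP.
  - by move: sj; case/orP => [/eqP -> | /eqP]; rewrite ?ltnn.
  - by case: i ij' {ij hs si sj}.
apply/and5P; split=> //.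
- by apply/allP => l; rewrite mem_iota => lij; apply/eqP/hs; lia.
- by case: i si {ij hs sj ij'} => //= i /(_ isT)/eqP.
- case: eqVneq => //= js; apply/eqP/sj; lia.
- by case: i ij' {ij hs si sj} => //= i; apply.
Qed.

Lemma mem_successions (s : seq bool) (ij : nat * nat) :
  (ij \in successions s) = is_succession s ij.
Proof.
rewrite mem_filter; case: ij => i j; apply: andb_idr => /successionP[ij _ _ _ _].
by apply/allpairsP; exists (i, j); rewrite !mem_iota /=; split=> //; lia.
Qed.

(** A run that starts strictly inside another one is not maximal to the left,
    and of two runs with the same start the shorter one is not maximal to the
    right. *)
Lemma succession_disjoint (s : seq bool) (i j i' j' : nat) :
  is_succession s (i, j) -> is_succession s (i', j') -> (i <= i')%N ->
  (i, j) = (i', j') \/ (j < i')%N.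
Proof.
move=> /successionP[ijs hs _ sj _] /successionP[ijs' hs' si' sj' _] ii'.
have [ji'|ji'] := ltnP j i'; [by right|left].
have [ei|nei] := eqVneq i i'; last first.
  have := si' ltac:(lia).
  by rewrite (hs i'.-1) ?(hs i') //; lia.
subst i'; congr (_, _).
case: (ltngtP j j') => // jj'.
- by have := sj ltac:(lia); rewrite hs' //; lia.
- by have := sj' ltac:(lia); rewrite hs //; lia.
Qed.

Lemma pairwise_allpairs_fst (T : eqType) (xs : seq nat) (ys : seq T) :
  pairwise leq xs ->
  pairwise (fun u v : nat * T => u.1 <= v.1)%N [seq (x, y) | x <- xs, y <- ys].
Proof.
elim: xs => //= x xs IHxs /andP[xxs /IHxs{}IHxs]; rewrite pairwise_cat IHxs andbT.
apply/andP; split.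
  apply/allrelP => u v /mapP[y _ ->] /allpairsP[[x' y'] [x'xs _ ->]] /=.
  by have /allP := xxs; apply.
rewrite pairwise_map; elim: ys {IHxs} => //= y ys ->; rewrite andbT.
by apply/allP => ? _; exact: leqnn.
Qed.

(** The pairs are enumerated by increasing first component; disjointness then
    puts the end of each succession before the start of the next one. *)
Lemma successions_sorted (s : seq bool) (k k' : nat) :
  (k < k' < size (successions s))%N ->
  ((nth (0, 0) (successions s) k).2 < (nth (0, 0) (successions s) k').1)%N.
Proof.
move=> /andP[kk' k's]; have ks := ltn_trans kk' k's.
have le1 : pairwise (fun u v : nat * nat => u.1 <= v.1)%N (successions s).
  apply/pairwise_filter/pairwise_allpairs_fst.
  by rewrite -sorted_pairwise; [exact: iota_sorted|exact: leq_trans].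
have uniq_s : uniq (successions s).
  rewrite filter_uniq // (allpairs_uniq _ _ (f := pair)) ?iota_uniq //.
  by move=> [? ?] [? ?] _ _.
have := nth_uniq (0, 0)%N ks k's uniq_s.
have := mem_nth (0, 0)%N ks; have := mem_nth (0, 0)%N k's.
have /(pairwiseP (0, 0)%N)/(_ _ _ ks k's kk') := le1.
case: (nth _ _ k) => i j; case: (nth _ _ k') => i' j' /= ii'.
rewrite !mem_successions => sij' sij.
have [->|//] := succession_disjoint sij sij' ii'.
by rewrite eqxx => /esym/eqP kE; rewrite kE ltnn in kk'.
Qed.

(** A succession of unions is followed by a join, because the whole string ends
    with a join. *)
Lemma essentialE (s : seq bool) (k i j : nat) :
  last false s -> (k < size (successions s))%N ->
  nth (0, 0)%N (successions s) k = (i, j) ->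
  essential s k.+1 = take (if nth false s i then j.+1 else j.+2) s.
Proof.
move=> last_s ks kE.
have sij : is_succession s (i, j) by rewrite -mem_successions -kE mem_nth.
have /successionP[ijs hs _ sj _] := sij.
have all_lt n : all (fun ij => ij.2 < n)%N (take k.+1 (successions s)) = (j < n)%N.
  apply/allP/idP => [all_n|jn u].
    have := all_n (i, j); apply; rewrite -kE -(@nth_take k.+1) //.
    by rewrite mem_nth // size_takel.
  case/(nthP (0, 0)%N) => l; rewrite size_takel // => lk <-.
  rewrite nth_take //; move: lk; rewrite ltnS leq_eqVlt => /predU1P[->|lk].
    by rewrite kE.
  have := @successions_sorted s l k; rewrite lk ks kE /= => /(_ isT); lia.
have last_take n : (n < size s)%N -> last false (take n.+1 s) = nth false s n.
  by move=> ns; rewrite (take_nth false) // last_rcons.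
have last_nth : nth false s (size s).-1 by rewrite nth_last.
rewrite /essential; congr take.
set P := (X in find X _); set N := (X in _ = X).
have [P_N N_min] : P N /\ forall n, (n < N)%N -> ~~ P n.
  rewrite /P /N; split.
    rewrite all_lt; case: ifP => si.
      by rewrite last_take ?ltnSn ?hs ?si; lia.
    have js : (j.+1 < size s)%N.
      rewrite ltn_neqAle; apply/andP; split; last by lia.
      apply/negP => /eqP js; move: last_nth; rewrite -js /= hs ?si //; lia.
    by rewrite last_take //; have := sj js; rewrite si; case: (nth _ _ _) => //; lia.
  move=> n nN; rewrite all_lt negb_and -leqNgt.
  have [|jn] := leqP n j; first by rewrite orbT.
  move: nN; case: ifP => si nN; first by lia.
  have -> : n = j.+1 by lia.
  by rewrite last_take ?hs ?si; lia.
have N_s : (N <= size s)%N.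
  rewrite leqNgt; apply/negP => sN; have := N_min _ sN.
  by rewrite /P all_lt take_size last_s; lia.
have has_P : has P (iota 0 (size s).+1).
  by apply/hasP; exists N => //; rewrite mem_iota; lia.
have := nth_find 0%N has_P; have := has_P; rewrite has_find size_iota => find_s.
rewrite nth_iota // add0n => P_find.
apply/eqP; rewrite eqn_leq; apply/andP; split.
  rewrite leqNgt; apply/negP => /(before_find 0%N).
  by rewrite nth_iota ?add0n ?P_N // ltnS.
rewrite leqNgt; apply/negP => /N_min; by rewrite P_find.
Qed.

(** In the essential substring the last letter of a run of unions is followed by
    a single join, which is a run of length one and not the first run; so no
    later succession appears. *)
Lemma take_succession (s : seq bool) (i j : nat) :
  is_succession s (i, j) -> last false s ->
  let N := if nth false s i then j.+1 else j.+2 in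
  [/\ (N <= size s)%N, is_succession (take N s) (i, j) &
      forall ij, is_succession (take N s) ij -> (ij.1 <= i)%N].
Proof.
move=> sij last_s N; have /successionP[ijs hs si sj ij'] := sij.
have last_nth : nth false s (size s).-1 by rewrite nth_last.
have N_s : (N <= size s)%N.
  rewrite /N; case: ifP => ci; first by lia.
  rewrite ltn_neqAle; apply/andP; split; last by lia.
  apply/negP => /eqP js; move: last_nth; rewrite -js /= hs ?ci //; lia.
have jN : (j < N)%N by rewrite /N; case: ifP.
have Nj : (N <= j.+2)%N by rewrite /N; case: ifP.
have tij : is_succession (take N s) (i, j).
  apply/successionP; rewrite size_takel //; split=> //.
  - lia.
  - by move=> l lij; rewrite !nth_take ?hs //; lia.
  - by move=> i0; rewrite !nth_take //; [apply: si|lia|lia].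
  - by move=> jN'; rewrite !nth_take //; [apply: sj; lia|lia].
split=> // -[i' j'] t' /=; rewrite leqNgt; apply/negP => ii'.
have [[e _]|ji'] := succession_disjoint tij t' (ltnW ii').
  by rewrite e ltnn in ii'.
have /successionP[] := t'; rewrite size_takel // => ijN' _ _ _ ij''; lia.
Qed.

Lemma last_succession_take (s : seq bool) (i j : nat) :
  is_succession s (i, j) -> last false s ->
  last_succession (take (if nth false s i then j.+1 else j.+2) s) = (i, j).
Proof.
move=> sij last_s; have [N_s tij tmax] := take_succession sij last_s.
set t := take _ s in tij tmax *; rewrite /last_succession.
have tij_mem : (i, j) \in successions t by rewrite mem_successions.
have [k ks kE] := nthP (0, 0)%N tij_mem.
rewrite -nth_last.
have [/eqP kl|kl] := boolP (k == (size (successions t)).-1); first by rewrite -kl kE.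
have := @successions_sorted t k (size (successions t)).-1.
have {}ks : (k < size (successions t))%N := ks.
have ls : ((size (successions t)).-1 < size (successions t))%N by lia.
have kls : (k < (size (successions t)).-1 < size (successions t))%N.
  by rewrite ls andbT ltn_neqAle kl; lia.
rewrite kE kls /= => /(_ isT).
have := tmax (nth (0, 0)%N (successions t) (size (successions t)).-1).
rewrite -mem_successions mem_nth // => /(_ isT).
have /successionP[] := tij; lia.
Qed.

Lemma maximal_run (s : seq bool) (a : nat) :
  (a < size s)%N ->
  exists i j, [/\ (i <= a <= j)%N, (j < size s)%N,
    homogeneous s i j,
    (0 < i)%N -> nth false s i.-1 <> nth false s i &
    (j.+1 < size s)%N -> nth false s j.+1 <> nth false s i].
Proof.
move=> as_.
have [i [ia hi si]] : exists i, [/\ (i <= a)%N,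
    forall l, (i <= l <= a)%N -> nth false s l = nth false s a &
    (0 < i)%N -> nth false s i.-1 <> nth false s a].
  elim: a {as_} => [|a [i [ia hi si]]].
    by exists 0%N; split=> // l l0; congr nth; lia.
  have [e|ne] := eqVneq (nth false s a) (nth false s a.+1); last first.
    by exists a.+1; split=> [//|l la|_]; [congr nth; lia|apply/eqP].
  exists i; split; [lia| |by rewrite -e].
  move=> l; have [->//|la ila] := eqVneq l a.+1.
  by rewrite -e; apply: hi; lia.
have [j [aj js hj sj]] : exists j, [/\ (a <= j)%N, (j < size s)%N,
    forall l, (a <= l <= j)%N -> nth false s l = nth false s a &
    (j.+1 < size s)%N -> nth false s j.+1 <> nth false s a].
  clear i ia hi si.
  have [n] := ubnP (size s - a); elim: n a as_ => // n IHn a as_ san.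
  have [as1|sa1] := ltnP a.+1 (size s); last first.
    exists a; split=> // [l la|]; [congr nth; lia|lia].
  have [e|ne] := eqVneq (nth false s a) (nth false s a.+1); last first.
    exists a; split=> // [l la|_]; first by congr nth; lia.
    by apply/eqP; rewrite eq_sym.
  have [j [aj js hj sj]] := IHn a.+1 as1 ltac:(lia).
  exists j; split=> //; [lia| |by rewrite e].
  move=> l; have [->//|la ila] := eqVneq l a.
  by rewrite e; apply: hj; lia.
have ia' : nth false s i = nth false s a by apply: hi; lia.
exists i, j; rewrite /homogeneous ia'; split=> //; first by lia.
by move=> l lij; have [la|la] := leqP l a; [apply: hi|apply: hj]; lia.
Qed.

Lemma first_succession (s : seq bool) :
  (0 < size s)%N ->
  exists j, (0 < size (successions s))%N /\
            nth (0, 0)%N (successions s) 0 = (0, j)%N.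
Proof.
move=> s0; have [i [j [i0 js hs si sj]]] := maximal_run s0.
move: i0; rewrite leqn0 andbT => /eqP i0; subst i.
have s0j : is_succession s (0, j)%N by apply/successionP; split.
have s0j_mem : (0, j)%N \in successions s by rewrite mem_successions.
have [k ks kE] := nthP (0, 0)%N s0j_mem.
case: k => [|k] in ks kE *; first by exists j.
by have := @successions_sorted s 0 k.+1; rewrite ks kE => /(_ isT).
Qed.

(** * Eigenvectors of the Laplacian of a threshold graph *)

(** Vectors are written as functions of the birth date, and the line tells at
    which position each entry stands. *)
Definition birth_row {R : realType} (s : seq bool) (f : nat -> R) :
    'rV[R]_(size s).+1 :=
  \row_r f (nth 0%N (line s) r).

Definition birth_entry {R : realType} (s : seq bool) (p : nat)
    (B : 'M[R]_((size s).+1, p)) (b : nat) (c : 'I_p) : R :=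
  B (inord (index b (line s))) c.

Lemma birth_row_mul {R : realType} (s : seq bool) (p : nat)
    (B : 'M[R]_((size s).+1, p)) (f : nat -> R) (c : 'I_p) :
  (birth_row s f *m B) 0 c = \sum_(0 <= b < (size s).+1) f b * birth_entry B b c.
Proof.
rewrite mxE -sum_line; apply: eq_bigr => r _; rewrite mxE /birth_entry.
by rewrite index_uniq ?line_uniq ?size_line // inord_val.
Qed.

Lemma birth_rowK {R : realType} (s : seq bool) (f : nat -> R) (b : nat) :
  (b <= size s)%N -> birth_row s f = 0 -> f b = 0.
Proof.
rewrite -mem_line => bs /rowP/(_ (inord (index b (line s)))).
by rewrite !mxE inordK ?nth_index // -size_line index_mem.
Qed.

Lemma birth_adj_sym (s : seq bool) (a b : nat) : birth_adj s a b = birth_adj s b a.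
Proof. by rewrite /birth_adj eq_sym maxnC. Qed.

Lemma birth_adjE (s : seq bool) (a b : nat) :
  (a < b)%N -> birth_adj s a b = nth false s b.-1.
Proof.
by move=> ab; rewrite /birth_adj neq_ltn ab /= (maxn_idPr (ltnW ab)).
Qed.

(** The Laplacian is symmetric, so it acts in the same way on row vectors. *)
Lemma birth_row_laplacian {R : realType} (s : seq bool) (f : nat -> R) :
  birth_row s f *m laplacian R (threshold s) =
  birth_row s (fun c =>
    \sum_(0 <= b < (size s).+1) (f c - f b) * (birth_adj s b c)%:R).
Proof.
apply/rowP => j; rewrite mulmxBr mul_mx_diag !mxE.
under [RHS]eq_bigr do rewrite mulrBl.
rewrite big_split /= sumrN -mulr_sumr; congr (_ * _ - _).
  rewrite -sum1_card natr_sum big_mkcond /=.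
  rewrite -(sum_line s (fun b => (birth_adj s b (nth 0%N (line s) j))%:R)).
  by apply: eq_bigr => k _; rewrite unfold_in /= /threshold birth_adj_sym; case: ifP.
rewrite -(sum_line s (fun b => f b * (birth_adj s b (nth 0%N (line s) j))%:R)).
by apply: eq_bigr => k _; rewrite !mxE.
Qed.

(** Letter [l], counted from [0], brings the vertex born at [l + 1]: the block of
    letters [i..j] brings the births [i + 1, ..., j + 1].  When
    the letters form a maximal run of a string that ends with a join, these
    vectors form an eigenspace. *)
Definition block_vector {R : realType} (i j : nat) (f : nat -> R) : Prop :=
  [/\ forall b, (b <= i)%N -> f b = f 0%N,
      forall b, (j.+1 < b)%N -> f b = 0 &
      \sum_(0 <= b < j.+2) f b = 0].

Definition joins_after (s : seq bool) (j : nat) : nat :=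
  (\sum_(j.+1 <= l < size s) nth false s l)%N.

(** A block of joins contributes [j + 2], the number of vertices present at
    its end; each join after the block contributes [1]. *)
Definition block_eigenvalue (s : seq bool) (j : nat) : nat :=
  (nth false s j * j.+2 + joins_after s j)%N.

(** Split the sum over the neighbours at the end of the block.  Two vertices
    [b], [c] born by then are adjacent as the letter of the block tells, unless
    both are born before the block; in that case [f b = f c] and adjacency does
    not matter.  A later vertex carries [f b = 0], and is adjacent either to all
    earlier vertices or to none of them. *)
Lemma block_vector_laplacian {R : realType} (s : seq bool) (i j : nat)
    (f : nat -> R) :
  (i <= j < size s)%N -> homogeneous s i j -> block_vector i j f ->
  birth_row s f *m laplacian R (threshold s) =
  (block_eigenvalue s j)%:R *: birth_row s f.
Proof.
move=> /andP[ij js] hs [fi fj fsum]; rewrite birth_row_laplacian.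
apply/rowP => r; rewrite !mxE; move: (nth 0%N (line s) r) => c.
rewrite (@big_cat_nat _ _ _ j.+2) //=.
have [cj|jc] := leqP c j.+1; last first.
  rewrite fj // mulr0 [X in _ + X = _](eq_big_nat _ _ (F2 := fun=> 0)); last first.
    by move=> b /andP[jb _]; rewrite fj // subrr mul0r.
  rewrite big1_eq addr0 (eq_big_nat _ _ (F2 := fun b => f b * (- (nth false s c.-1)%:R))).
    by rewrite -mulr_suml fsum mul0r.
  move=> b bj; rewrite birth_adjE; last by lia.
  by rewrite sub0r mulrN mulNr.
(* the vertices born up to the end of the block *)
have -> : \sum_(0 <= b < j.+2) (f c - f b) * (birth_adj s b c)%:R =
          (nth false s j * j.+2)%:R * f c.
  rewrite (eq_big_nat _ _ (F2 := fun b => (f c - f b) * (nth false s j)%:R)).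
    rewrite -mulr_suml big_split /= sumrN fsum subr0 sumr_const_nat subn0.
    by rewrite natrM -[f c *+ _]mulr_natr; ring.
  move=> b bj; rewrite /birth_adj; have [->|bc] /= := eqVneq b c.
    by rewrite subrr !mul0r.
  have [mi|im] := leqP (maxn b c) i.
    by rewrite (fi c) ?(fi b) ?subrr ?mul0r //; lia.
  by rewrite (hs (maxn b c).-1) ?(hs j) //; lia.
have -> : \sum_(j.+2 <= b < (size s).+1) (f c - f b) * (birth_adj s b c)%:R =
          (joins_after s j)%:R * f c.
  rewrite big_add1 /= /joins_after natr_sum mulr_suml.
  apply: eq_big_nat => l /andP[jl _]; rewrite (fj l.+1) // subr0 birth_adj_sym.
  by rewrite birth_adjE; [exact: mulrC|lia].
by rewrite /block_eigenvalue natrD mulrDl.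
Qed.

Lemma const_laplacian {R : realType} (s : seq bool) (x : R) :
  birth_row s (fun=> x) *m laplacian R (threshold s) = 0.
Proof.
rewrite birth_row_laplacian; apply/rowP => r; rewrite !mxE.
by apply: big1 => b _; rewrite subrr mul0r.
Qed.

Lemma block_eigenvalue_gt0 (s : seq bool) (j : nat) :
  last false s -> (j < size s)%N -> (0 < block_eigenvalue s j)%N.
Proof.
move=> last_s js; rewrite addn_gt0.
have last_nth : nth false s (size s).-1 by rewrite nth_last.
have [e|ne] := eqVneq j.+1 (size s); first by rewrite -e /= in last_nth; rewrite last_nth.
have ss : size s = (size s).-1.+1 by lia.
by rewrite /joins_after ss big_nat_recr /= ?last_nth ?addn1 ?orbT //; lia.
Qed.

(** Let [K] be the number of joins among the letters [i+1..j].  The equality of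
    the eigenvalues says that [K] is the difference of [j + 2] or [0], if letter
    [j] is a join or a union, and [i + 2] or [0], according to letter [i].  As
    [K] lies between [0] and [j - i], both letters agree and [K] is [j - i] or
    [0], respectively. *)
Lemma block_eigenvalue_inj (s : seq bool) (i j : nat) :
  (i <= j < size s)%N -> block_eigenvalue s i = block_eigenvalue s j ->
  homogeneous s i j.
Proof.
move=> /andP[ij js].
pose K := (\sum_(i.+1 <= l < j.+1) nth false s l)%N.
have joinsE : joins_after s i = (K + joins_after s j)%N.
  by rewrite /joins_after /K [LHS](@big_cat_nat _ _ _ j.+1).
have [K_le K_all K_none] : [/\ (K <= j - i)%N,
    K = (j - i)%N -> forall l, (i < l <= j)%N -> nth false s l = true &
    K = 0%N -> forall l, (i < l <= j)%N -> nth false s l = false].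
  rewrite /K; elim: j ij {js joinsE K} => [|j IHj] ij.
    by rewrite big_geq //; split=> // *; lia.
  have [->|ij'] := eqVneq i j.+1; first by rewrite big_geq //; split=> // *; lia.
  have [K_le K_all K_none] := IHj ltac:(lia).
  rewrite big_nat_recr /=; last by lia.
  set K := (X in (X + _)%N) in K_le K_all K_none *.
  case E: (nth false s j.+1); split; try lia.
  - move=> KE l lij; have [->//|lj] := eqVneq l j.+1; apply: K_all; lia.
  - move=> KE l lij; have [->//|lj] := eqVneq l j.+1; apply: K_none; lia.
rewrite /block_eigenvalue joinsE => e l lij.
have [->//|li] := eqVneq l i.
move: e; case Ei: (nth false s i); case Ej: (nth false s j) => e.
- by apply: K_all; lia.
- by lia.
- by lia.
- by apply: K_none; lia.
Qed.

(** In birth dates: the constant vector for [a = 0], and otherwise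
    [a e_a - sum_(b < a) e_b], which spans the block vectors of the single
    letter that brings [a]. *)
Definition threshold_vec {R : realType} (a b : nat) : R :=
  if a is a'.+1 then
    if (b <= a')%N then -1 else if b == a then a%:R else 0
  else 1.

Lemma threshold_vec_block {R : realType} (a : nat) :
  block_vector a a (threshold_vec a.+1 : nat -> R).
Proof.
split=> [b ba|b ab|] /=.
- by rewrite ba.
- by rewrite leqNgt (ltnW ab) /= gtn_eqF.
rewrite big_nat_recr //= (eq_big_nat _ _ (F2 := fun=> -1)).
  by rewrite sumr_const_nat subn0 ltnn eqxx mulNrn addNr.
by move=> b /andP[_]; rewrite ltnS => ->.
Qed.

Definition threshold_basis {R : realType} (s : seq bool) : 'M[R]_((size s).+1) :=
  \matrix_(a, r) threshold_vec a (nth 0%N (line s) r).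

Definition threshold_eigenvalue (s : seq bool) (a : nat) : nat :=
  if a is a'.+1 then block_eigenvalue s a' else 0.

Lemma row_threshold_basis {R : realType} (s : seq bool) (a : 'I_(size s).+1) :
  row a (@threshold_basis R s) = birth_row s (threshold_vec a).
Proof. by apply/rowP => r; rewrite !mxE. Qed.

Lemma threshold_basis_laplacian {R : realType} (s : seq bool) :
  threshold_basis s *m laplacian R (threshold s) =
  diag_mx (\row_a (threshold_eigenvalue s a)%:R) *m threshold_basis s.
Proof.
apply/row_matrixP => a; rewrite row_mul row_threshold_basis.
transitivity ((threshold_eigenvalue s a)%:R *: row a (@threshold_basis R s)); last first.
  by apply/rowP => r; rewrite mul_diag_mx !mxE.
rewrite row_threshold_basis.
case: a => -[|a] a_s /=; first by rewrite const_laplacian scale0r.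
apply: (block_vector_laplacian (i := a)); [by rewrite leqnn -ltnS| |].
  by move=> l la; congr nth; lia.
exact: threshold_vec_block.
Qed.

(** The rows are nonzero and orthogonal: the later of two of them is constant on
    the support of the earlier one, which has sum zero unless it is the constant
    vector. *)
Lemma threshold_basis_unit {R : realType} (s : seq bool) :
  @threshold_basis R s \in unitmx.
Proof.
set V := threshold_basis s.
have dotE a a' : (V *m V^T) a a' =
    \sum_(0 <= b < (size s).+1) threshold_vec a b * threshold_vec a' b.
  rewrite mxE -(sum_line s (fun b => threshold_vec a b * threshold_vec a' b)).
  by apply: eq_bigr => r _; rewrite !mxE.
have sum_vec (a : nat) : (a < size s)%N ->
    \sum_(0 <= b < (size s).+1) (threshold_vec a.+1 b : R) = 0.
  move=> a_s; have [_ va0 va] := @threshold_vec_block R a.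
  rewrite (@big_cat_nat _ _ _ a.+2) // va Monoid.mul1m.
  rewrite (eq_big_nat _ _ (F2 := fun=> 0)) ?big1_eq // => b /andP[ab _].
  exact: va0.
have orth (a a' : 'I_(size s).+1) : (a < a')%N -> (V *m V^T) a a' = 0.
  case: a' => -[|a'] a's //=; rewrite ltnS => aa'.
  rewrite dotE; case: a aa' => -[|a] a_s /= aa'.
    under eq_bigr do rewrite mul1r; exact: sum_vec.
  transitivity (- \sum_(0 <= b < (size s).+1) (threshold_vec a.+1 b : R)); last first.
    by rewrite sum_vec ?oppr0.
  rewrite -sumrN; apply: eq_bigr => b _.
  have [ba'|a'b] := leqP b a'; first by rewrite mulrN1.
  have [_ va0 _] := @threshold_vec_block R a.
  have := va0 b ltac:(lia); rewrite /= => ->; by rewrite mul0r oppr0.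
pose d := \row_a (V *m V^T) a a.
have VV : V *m V^T = diag_mx d.
  apply/matrixP => a a'; rewrite [RHS]mxE.
  have [->|ne] := eqVneq a a'; first by rewrite mulr1n [RHS]mxE.
  rewrite mulr0n; have := ne; rewrite -val_eqE neq_ltn => /orP[aa'|a'a].
    exact: orth.
  transitivity ((V *m V^T) a' a); last exact: orth.
  by rewrite !dotE; apply: eq_bigr => b _; exact: mulrC.
rewrite unitmxE unitfE; apply/eqP => V0.
have : \det (V *m V^T) = 0 by rewrite det_mulmx V0 mul0r.
rewrite VV det_diag => /eqP/prodf_eq0[a _].
rewrite mxE dotE => /eqP va0.
have := va0; move/eqP; rewrite psumr_eq0 => [/allP/(_ 0%N)|b _]; last first.
  by rewrite -expr2 sqr_ge0.
rewrite mem_index_iota => /(_ isT) /=; rewrite -expr2 sqrf_eq0.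
by case: (nat_of_ord a) => [|a'] /=; rewrite ?oppr_eq0 oner_eq0.
Qed.

(** * Checking matrices as bases of eigenspaces *)

Lemma sum_delta {R : nzRingType} (m n x : nat) :
  \sum_(m <= l < n) (l == x)%:R = (m <= x < n)%N%:R :> R.
Proof.
have [mn|nm] := leqP m n; last first.
  by rewrite big_geq ?(ltnW nm) //; case E: (_ && _) => //; lia.
rewrite -(subnKC mn); elim: (n - m)%N => [|d IHd].
  by rewrite addn0 big_geq //; case E: (_ && _) => //; lia.
rewrite addnS big_nat_recr ?leq_addr //= IHd -natrD; congr _%:R; lia.
Qed.

Lemma block_vector_sum {R : realType} (i j n : nat) (f x : nat -> R) :
  block_vector i j f -> (j.+2 <= n)%N ->
  \sum_(0 <= b < n) f b * x b = \sum_(0 <= b < j.+2) f b * x b.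
Proof.
move=> [_ f0 _] jn; rewrite (@big_cat_nat _ _ _ j.+2) //=.
rewrite [X in _ + X = _](eq_big_nat _ _ (F2 := fun=> 0)) ?big1_eq ?addr0 //.
by move=> b /andP[jb _]; rewrite f0 // mul0r.
Qed.

Lemma block_vector_comb {R : realType} (I : finType) (i j : nat) (g : I -> R)
    (f : I -> nat -> R) :
  (forall k, g k != 0 -> block_vector i j (f k)) ->
  block_vector i j (fun b => \sum_k g k * f k b).
Proof.
move=> fP; have gP k (x y : R) :
    (block_vector i j (f k) -> x = y) -> g k * x = g k * y.
  by move=> xy; have [->|/fP/xy ->] := eqVneq (g k) 0; rewrite ?mul0r.
split=> [b bi|b jb|].
- by apply: eq_bigr => k _; apply: gP => -[fi _ _]; exact: fi.
- by apply: big1 => k _; rewrite -[RHS](mulr0 (g k)); apply: gP => -[_ f0 _]; exact: f0.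
rewrite exchange_big /=; apply: big1 => k _.
by rewrite -mulr_sumr -[RHS](mulr0 (g k)); apply: gP => -[].
Qed.

(** The columns of a checking matrix ([k] counted from [0]) in birth dates; in
    these, the cases of joins, of unions and of a single succession have one
    and the same formula. *)
Definition checking_vec {R : realType} (i j k b : nat) : R :=
  if (k < j - i)%N then (b == j.+1)%:R - (b == (j - k)%N)%:R
  else i.+1%:R * (b == j.+1)%:R - (b <= i)%N%:R.

Lemma checking_vec_block {R : realType} (i j k : nat) :
  (i <= j)%N -> block_vector i j (checking_vec i j k : nat -> R).
Proof.
move=> ij; rewrite /checking_vec; split=> [b bi|b jb|].
- case: ltnP => kji; first by congr (_%:R - _%:R); lia.
  by rewrite leq0n bi; congr (_ * _%:R - _); lia.
- have -> : (b == j.+1) = false by lia.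
  case: ltnP => kji.
    have -> : (b == (j - k)%N) = false by lia.
    by rewrite subrr.
  have -> : (b <= i)%N = false by lia.
  by rewrite mulr0 subrr.
case: ltnP => kji; rewrite big_split /= sumrN -?mulr_sumr !sum_delta.
  by rewrite !leq0n !ltnS leqnn leqW ?leq_subr //= subrr.
rewrite (@big_cat_nat _ _ _ i.+1) //=; last by lia.
rewrite (eq_big_nat _ _ (F2 := fun=> 1)) => [|b /andP[_]]; last by rewrite ltnS => ->.
rewrite [X in _ - (_ + X)](eq_big_nat _ _ (F2 := fun=> 0)); last first.
  move=> b /andP[ib _].
  by rewrite leqNgt ib.
by rewrite big1_eq addr0 sumr_const_nat subn0 leqnn mulr1 subrr.
Qed.

(** The births [j, j - 1, ..., i] are pivots for the columns. *)
Lemma checking_vec_pivot {R : realType} (i j k l : nat) :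
  (i <= j)%N -> (k <= j - i)%N -> (l <= j - i)%N ->
  checking_vec i j k (j - l) = - (k == l)%:R :> R.
Proof.
move=> ij kji lji; rewrite /checking_vec (_ : (j - l == j.+1)%N = false); last by lia.
case: ltnP => kji'; rewrite ?mulr0 sub0r; congr (- _%:R); lia.
Qed.

(** By the pivots, both sides agree on the births [i, ..., j]; since both are
    block vectors, they agree on the births up to [i] by constancy and at
    [j + 1] by the vanishing of the sum. *)
Lemma checking_vec_coord {R : realType} (i j n : nat) (f : nat -> R) (b : nat) :
  (i <= j)%N -> n = (j.+1 - i)%N -> block_vector i j f -> (b <= j.+1)%N ->
  f b = \sum_(k < n) - f (j - k)%N * checking_vec i j k b.
Proof.
move=> ij nE fP bj; pose h a := \sum_(k < n) - f (j - k)%N * checking_vec i j k a.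
rewrite -/(h b).
have hP : block_vector i j h.
  by apply: block_vector_comb => k _; exact: checking_vec_block.
have hE l : (l <= j - i)%N -> h (j - l)%N = f (j - l)%N.
  move=> lji; rewrite /h.
  rewrite -(big_mkord xpredT (fun k => - f (j - k)%N * checking_vec i j k (j - l))).
  rewrite (eq_big_nat _ _ (F2 := fun k => f (j - l)%N * (k == l)%:R)).
    by rewrite -mulr_sumr sum_delta (_ : (0 <= l < n)%N) ?mulr1 //; lia.
  move=> k kji; rewrite checking_vec_pivot //; try lia.
  by rewrite mulrNN; case: eqP => [->//|_]; rewrite !mulr0.
have [fi _ fsum] := fP; have [hi _ hsum] := hP.
have fh a : (a <= j)%N -> f a = h a.
  move=> aj; have [ai|ia] := leqP a i; last first.
    by rewrite -[a](_ : j - (j - a) = a)%N ?hE //; lia.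
  rewrite fi // hi // -(fi i) // -(hi i) //.
  by have := hE (j - i)%N (leqnn _); rewrite subKn.
have [bj'|jb] := leqP b j; first exact: fh.
have -> : b = j.+1 by lia.
move: fsum hsum; rewrite !(@big_nat_recr _ _ _ j.+1) //=.
rewrite (eq_big_nat _ _ (F2 := h)); last first.
  by move=> a /andP[_ aj]; exact: fh.
by move=> fs hs; apply: (@addrI _ (\sum_(0 <= a < j.+1) h a)); rewrite fs hs.
Qed.

Lemma only_first_succession (t : seq bool) (i j : nat) :
  (0 < size t)%N -> last_succession t = (i, j) ->
  size (successions t) = 1%N -> i = 0%N.
Proof.
move=> t0; have [j' [_]] := first_succession t0.
by rewrite /last_succession; case: (successions t) => [//|u [|//]] /= -> [-> _].
Qed.

Lemma evecE {R : realType} (n l : nat) (r : 'I_n) : evec R n l r 0 = (l == r.+1)%:R.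
Proof. by rewrite mxE eq_sym. Qed.

Lemma evec_revE {R : realType} (n l : nat) (r : 'I_n) :
  evec_rev R n l r 0 = (l == n - r)%N%:R.
Proof. by rewrite mxE; congr _%:R; have := ltn_ord r; lia. Qed.

(** The shape of an essential substring whose last succession is [i..j]. *)
Record closes_block (t : seq bool) (i j : nat) : Prop := ClosesBlock {
  closes_last : last_succession t = (i, j);
  closes_le : (i <= j)%N;
  closes_homogeneous : homogeneous t i j;
  closes_size : size t = if nth false t i then j.+1 else j.+2;
  closes_join : nth false t i = false -> nth false t j.+1 = true
}.

(** The position of a vertex in the run determines its birth date, by
    [line_final_joins] and [line_final_unions].  When the succession is the only
    one, [i = 0] and the sum in the general last column has a single term. *)
Lemma checking_colE {R : realType} (t : seq bool) (i j k : nat)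
    (r : 'I_(size t).+1) :
  closes_block t i j -> (k <= j - i)%N ->
  checking_col R t k.+1 r 0 = checking_vec i j k (nth 0%N (line t) r).
Proof.
case=> lastE ij hs st tj kji.
have only_i : size (successions t) = 1%N -> i = 0%N.
  by apply: only_first_succession lastE; rewrite st; case: ifP.
have := ltn_ord r; rewrite /checking_col /last_letter /last_length lastE /=.
have -> : (k.+1 < j.+1 - i)%N = (k < j - i)%N by lia.
rewrite /checking_vec; case ci: (nth false t i) st tj => st tj rn.
- have := @line_final_joins t i j r ij st hs ci ltac:(lia).
  set b := nth 0%N (line t) r => bE.
  have e1 : (1 == r.+1)%N = (b == j.+1) by move: bE; case: ifP; lia.
  case: ltnP => kji'.
    rewrite !mxE !(eq_sym r.+1) e1; congr (_ - _%:R); congr nat_of_bool.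
    by move: bE; case: ifP; lia.
  case: (eqVneq _ 1%N) => [/only_i i0|_].
    subst i; rewrite !mxE !(eq_sym r.+1) e1 mul1r; congr (_ - _%:R).
    by congr nat_of_bool; move: bE; case: ifP; lia.
  rewrite mxE [X in X + _]mxE [X in _ + X]mxE summxE.
  under eq_bigr do rewrite evecE.
  rewrite sum_delta evecE e1; congr (_%:R * _ - _%:R); first by lia.
  by congr nat_of_bool; move: bE; case: ifP; lia.
have := @line_final_unions t i j r ij st hs ci (tj erefl) ltac:(lia).
set b := nth 0%N (line t) r => bE.
have e1 : (r + 1 == (size t).+1)%N = (b == j.+1) by move: bE; do ?case: ifP => ?; lia.
case: ltnP => kji'.
  rewrite !mxE e1; congr (_ - _%:R); congr nat_of_bool.
  by move: bE; do ?case: ifP => ?; lia.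
case: (eqVneq _ 1%N) => [/only_i i0|_].
  subst i; rewrite !mxE e1 mul1r; congr (_ - _%:R).
  by congr nat_of_bool; move: bE; do ?case: ifP => ?; lia.
rewrite mxE [X in X + _]mxE [X in _ + X]mxE summxE.
under eq_bigr do rewrite evec_revE.
rewrite sum_delta mxE e1; congr (_%:R * _ - _%:R); first by lia.
by congr nat_of_bool; move: bE; do ?case: ifP => ?; lia.
Qed.

Lemma birth_row0 {R : realType} (s : seq bool) (f : nat -> R) :
  (forall b, f b = 0) -> birth_row s f = 0.
Proof. by move=> f0; apply/rowP => r; rewrite !mxE f0. Qed.

(** A vanishing combination of the rows is a block vector annihilated by [B],
    and all block vectors are combinations of the columns of the checking
    matrix. *)
Lemma row_free_checkingP {R : realType} (s t : seq bool) (i j p : nat)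
    (B : 'M[R]_((size s).+1, p)) :
  closes_block t i j -> (j < size t <= size s)%N ->
  row_free ((checking R t)^T *m local_control t B) <->
  (forall f, block_vector i j f -> birth_row s f *m B = 0 -> birth_row s f = 0).
Proof.
move=> tP /andP[jt ts]; set M := _ *m _; have ij := closes_le tP.
have mE : last_length t = (j.+1 - i)%N by rewrite /last_length (closes_last tP).
have ME (k : 'I_(last_length t)) c :
    M k c = \sum_(0 <= b < j.+2) checking_vec i j k b * birth_entry B b c.
  rewrite mxE -(@block_vector_sum _ i j (size t).+1) ?ltnS //; last first.
    exact: checking_vec_block.
  rewrite -sum_line; apply: eq_bigr => r _; rewrite !mxE (checking_colE _ tP) //.
  by have := ltn_ord k; lia.
have vME (v : 'rV_(last_length t)) c : (v *m M) 0 c =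
    \sum_(0 <= b < j.+2) (\sum_k v 0 k * checking_vec i j k b) * birth_entry B b c.
  under [RHS]eq_bigr do rewrite mulr_suml.
  rewrite exchange_big /= mxE; apply: eq_bigr => k _; rewrite ME mulr_sumr.
  by apply: eq_bigr => b _; rewrite mulrA.
have fBE (f : nat -> R) c : block_vector i j f ->
    (birth_row s f *m B) 0 c = \sum_(0 <= b < j.+2) f b * birth_entry B b c.
  by move=> fP; rewrite birth_row_mul (block_vector_sum _ fP) //; lia.
split=> [Mfree f fP fB|Bfree].
  pose v := \row_(k < last_length t) - f (j - k)%N.
  have fv b : (b <= j.+1)%N -> f b = \sum_k v 0 k * checking_vec i j k b.
    move=> bj; rewrite (checking_vec_coord ij mE fP bj).
    by apply: eq_bigr => k _; rewrite mxE.
  have /eqP : v *m M = 0.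
    apply/rowP => c; rewrite vME mxE -[RHS](_ : (birth_row s f *m B) 0 c = 0).
      rewrite fBE //; apply: eq_big_nat => b /andP[_ bj]; rewrite -fv //; lia.
    by rewrite fB mxE.
  rewrite mulmx_free_eq0 // => /eqP v0; apply: birth_row0 => b.
  have [bj|jb] := leqP b j.+1; last by case: fP => _ f0 _; exact: f0.
  by rewrite fv // v0; apply: big1 => k _; rewrite mxE mul0r.
apply: inj_row_free => v vM.
pose f b := \sum_k v 0 k * checking_vec i j k b.
have fP : block_vector i j f.
  by apply: block_vector_comb => k _; exact: checking_vec_block.
have f0 : birth_row s f = 0.
  by apply: Bfree => //; apply/rowP => c; rewrite fBE // -vME vM.
apply/rowP => l; rewrite mxE; apply/eqP; rewrite -oppr_eq0 -mulrN1; apply/eqP.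
have lm : (l < j.+1 - i)%N by rewrite -mE.
have := birth_rowK (b := j - l) _ f0; rewrite /f (bigD1 l) //= big1 => [|k kl].
  rewrite addr0 checking_vec_pivot ?eqxx; [apply; lia|lia..].
have km : (k < j.+1 - i)%N by rewrite -mE.
rewrite checking_vec_pivot; [|lia..].
by rewrite (_ : (k == l :> nat) = false) ?oppr0 ?mulr0 //; apply/negbTE.
Qed.

Lemma essential_closes (s : seq bool) (k i j : nat) :
  last false s -> (k < size (successions s))%N ->
  nth (0, 0)%N (successions s) k = (i, j) ->
  closes_block (essential s k.+1) i j /\
  (j < size (essential s k.+1) <= size s)%N.
Proof.
move=> last_s ks kE; rewrite (essentialE last_s ks kE).
have sij : is_succession s (i, j) by rewrite -mem_successions -kE mem_nth.
have [N_s tij _] := take_succession sij last_s.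
have /successionP[ijs hs si sj _] := sij.
have lastE := last_succession_take sij last_s.
set N := (if _ then _ else _) in N_s tij lastE *.
have jN : (j < N)%N by rewrite /N; case: ifP.
have tE l : (l < N)%N -> nth false (take N s) l = nth false s l.
  by move=> lN; rewrite nth_take.
have sz : size (take N s) = N by rewrite size_takel.
split; last by rewrite sz jN.
split=> //; first by lia.
- by move=> l lij; rewrite !tE ?hs //; lia.
- by rewrite tE //; lia.
rewrite tE; last by lia.
move=> ci; have NE : N = j.+2 by rewrite /N ci.
rewrite tE; last by rewrite NE.
by have := sj ltac:(lia); rewrite ci; case: (nth _ _ _).
Qed.

(** The coordinates of [q] in the eigenbasis vanish outside one eigenvalue.
    As the eigenvalue of the constants is [0] and the others are positive, these
    coordinates belong to the constant vector only or to births brought by one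
    maximal run. *)
Lemma threshold_eigenvector {R : realType} (s : seq bool) (lam : R)
    (q : 'rV[R]_(size s).+1) :
  last false s -> q *m laplacian R (threshold s) = lam *: q ->
  (exists x, q = birth_row s (fun=> x)) \/
  exists i j f, [/\ (i <= j < size s)%N, homogeneous s i j,
    (0 < i)%N -> nth false s i.-1 <> nth false s i,
    (j.+1 < size s)%N -> nth false s j.+1 <> nth false s i &
    block_vector i j f /\ q = birth_row s f].
Proof.
move=> last_s qL; have Vu := @threshold_basis_unit R s.
set V := threshold_basis s in Vu; pose c := q *m invmx V.
have qE : q = c *m V by rewrite mulmxKV.
have qf : q = birth_row s (fun b => \sum_(a < (size s).+1) c 0 a * threshold_vec a b).
  apply/rowP => r; rewrite {1}qE !mxE; apply: eq_bigr => a _; by rewrite [V _ _]mxE.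
have cE a : c 0 a != 0 -> (threshold_eigenvalue s a)%:R = lam.
  have : c *m diag_mx (\row_a (threshold_eigenvalue s a)%:R) = lam *: c.
    apply: (can_inj (mulmxK Vu)).
    by rewrite -mulmxA -threshold_basis_laplacian mulmxA -qE qL -scalemxAl -qE.
  move/rowP/(_ a); rewrite mul_mx_diag !mxE mulrC => /eqP.
  by rewrite -subr_eq0 -mulrBl mulf_eq0 subr_eq0 => /orP[/eqP//|->].
case: (boolP [exists a : 'I_(size s).+1, (0 < a)%N && (c 0 a != 0)]); last first.
  move=> /existsPn c0; left; exists (c 0 0); rewrite qf; congr birth_row.
  apply/funext => b; rewrite (bigD1 0) //= big1 ?addr0 ?mulr1 // => a a0.
  by have := c0 a; rewrite lt0n a0 /= negbK => /eqP ->; rewrite mul0r.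
move=> /existsP[[[|a] aS] //= ca]; right; have a_s : (a < size s)%N by [].
have [i [j [iaj js hs si sj]]] := maximal_run a_s.
exists i, j, (fun b => \sum_(a < (size s).+1) c 0 a * threshold_vec a b).
split=> //; first by lia.
split=> //; apply: block_vector_comb => -[[|a'] a'S] /= /cE ca'.
  have /eqP := cE _ ca; rewrite -ca' /= eqr_nat => /eqP e0.
  by have := block_eigenvalue_gt0 last_s a_s; rewrite e0.
have {ca'} /eqP := etrans (cE _ ca) (esym ca'); rewrite /= eqr_nat => /eqP ea.
have a's : (a' < size s)%N by [].
have ia'j : (i <= a' <= j)%N.
  have [aa'|a'a] := leqP a a'.
    have ha := @block_eigenvalue_inj s a a' ltac:(lia) ea.
    apply/andP; split; first by lia.
    rewrite leqNgt; apply/negP => ja'; have /sj := leq_ltn_trans ja' a's.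
    by apply; rewrite ha ?(hs a) //; lia.
  have ha := @block_eigenvalue_inj s a' a ltac:(lia) (esym ea).
  apply/andP; split; last by lia.
  rewrite leqNgt; apply/negP => a'i; have /si := leq_ltn_trans (leq0n _) a'i.
  by apply; rewrite ha ?(hs i) //; [rewrite -(ha a) ?(hs a) //; lia|lia].
have [v1 v0 vsum] := @threshold_vec_block R a'.
change (block_vector i j (threshold_vec a'.+1 : nat -> R)).
split=> [b bi|b jb|]; [by apply: v1; lia|by apply: v0; lia|].
rewrite (@big_cat_nat _ _ _ a'.+2) //; last by lia.
rewrite vsum Monoid.mul1m (eq_big_nat _ _ (F2 := fun=> 0)) ?big1_eq // => b ab.
by apply: v0; lia.
Qed.

Lemma binary_mean {R : realType} (n : nat) (x : nat -> R) (y : R) :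
  (forall b, x b = 0 \/ x b = 1) -> y = 0 \/ y = 1 ->
  \sum_(0 <= b < n) x b = n%:R * y -> forall b, (b < n)%N -> x b = y.
Proof.
move=> x01 y01 xy b bn.
have bS : b \in index_iota 0 n by rewrite mem_index_iota.
case: y01 => yE; rewrite yE in xy *.
  move: xy; rewrite mulr0 => /eqP; rewrite psumr_eq0 => [/allP/(_ b bS)/eqP //|a _].
  by case: (x01 a) => ->.
have : \sum_(0 <= a < n) (1 - x a) = 0.
  by rewrite big_split /= sumrN xy sumr_const_nat subn0 mulr1 subrr.
move/eqP; rewrite psumr_eq0 => [/allP/(_ b bS)|a _]; last first.
  by case: (x01 a) => ->; rewrite ?subrr ?subr0.
by rewrite /= subr_eq0 => /eqP <-.
Qed.

Lemma connected_last (s : seq bool) :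
  (0 < size s)%N -> connected_graph (threshold s) -> last false s.
Proof.
move=> s0 conn; pose r : 'I_(size s).+1 := inord (index (size s) (line s)).
have rE : nth 0%N (line s) r = size s.
  by rewrite inordK ?nth_index ?mem_line // -size_line index_mem mem_line.
have [r' r'r] : exists r' : 'I_(size s).+1, r' != r.
  have [e|ne] := eqVneq r 0; last by exists 0; rewrite eq_sym.
  by exists ord_max; rewrite e -val_eqE /=; lia.
have /connectP[[|x pth] /=] := conn r r'.
  by move=> _ e; rewrite e eqxx in r'r.
case/andP=> rx _ _; move: rx; rewrite /threshold rE /birth_adj => /andP[_].
rewrite (maxn_idPl _) ?nth_last // birth_le // -ltnS; exact: ltn_ord.
Qed.

(** * Reduction to the successions *)

Lemma threshold_controllableP {R : realType} (s : seq bool) (p : nat)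
    (B : 'M[R]_((size s).+1, p)) :
  controllable (- laplacian R (threshold s)) B <->
  hautus (- laplacian R (threshold s)) B.
Proof.
split; first exact: controllable_hautus.
apply: (hautus_controllable (V := threshold_basis s)
  (d := \row_a - (threshold_eigenvalue s a)%:R)); first exact: threshold_basis_unit.
rewrite mulmxN threshold_basis_laplacian -mulNmx -linearN /=; congr (diag_mx _ *m _).
by apply/rowP => a; rewrite !mxE.
Qed.

(** A column that is constant on the births up to [j + 1] is orthogonal to the
    block vectors of [0..j], which have sum zero there. *)
Lemma first_check_not_constant {R : realType} (s : seq bool) (p j : nat)
    (B : 'M[R]_((size s).+1, p)) :
  last false s -> (0 < size (successions s))%N ->
  nth (0, 0)%N (successions s) 0 = (0, j)%N ->
  row_free ((checking R (essential s 1))^T *m local_control (essential s 1) B) ->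
  ~ forall b c, (b <= j.+1)%N -> birth_entry B b c = birth_entry B 0 c.
Proof.
move=> last_s s0 sE; have [tP jts] := essential_closes last_s s0 sE.
move=> /(row_free_checkingP _ tP jts) Bfree Bconst.
pose f : nat -> R := checking_vec 0 j 0.
have fP : block_vector 0 j f by exact: checking_vec_block.
have [_ _ fsum] := fP.
have /birth_rowK f0 : birth_row s f = 0.
  apply: Bfree => //; apply/rowP => c.
  rewrite birth_row_mul (block_vector_sum _ fP); last by lia.
  rewrite (eq_big_nat _ _ (F2 := fun b => f b * birth_entry B 0 c)).
    by rewrite -mulr_suml fsum mul0r mxE.
  by move=> b /andP[_ bj]; rewrite Bconst.
have := f0 (j - 0)%N ltac:(lia).
by rewrite /f checking_vec_pivot // => /eqP; rewrite oppr_eq0 oner_eq0.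
Qed.

(** An eigenvector annihilated by [B] that is not covered by a succession is
    constant or belongs to a run [i..i] with [0 < i]; by binarity [B] would then
    be constant on the vertices that the first succession involves. *)
Lemma checks_hautus {R : realType} (s : seq bool) (p : nat)
    (B : 'M[R]_((size s).+1, p)) :
  (0 < size s)%N -> last false s -> (forall i j, B i j = 0 \/ B i j = 1) ->
  (forall i : nat, (1 <= i <= size (successions s))%N ->
     row_free ((checking R (essential s i))^T
               *m local_control (essential s i) B)) ->
  hautus (- laplacian R (threshold s)) B.
Proof.
move=> s_gt0 last_s B01 Bfree lam q qL qB.
have [j1 [succ_gt0 succ0]] := first_succession s_gt0.
have s0j1 : is_succession s (0, j1)%N by rewrite -mem_successions -succ0 mem_nth.
have := first_check_not_constant last_s succ_gt0 succ0 (Bfree 1%N succ_gt0).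
move=> Bconst; have entry01 b c : birth_entry B b c = 0 \/ birth_entry B b c = 1.
  exact: B01.
have {}qL : q *m laplacian R (threshold s) = - lam *: q.
  by rewrite scaleNr -qL mulmxN opprK.
have [[x qE]|[i [j [f [ij hs si sj [fP qE]]]]]] := threshold_eigenvector last_s qL.
  have [x0|x0] := eqVneq x 0; first by rewrite qE; apply: birth_row0.
  have B0 b c : (b <= size s)%N -> birth_entry B b c = 0.
    move=> bs; apply: (@binary_mean _ (size s).+1 (birth_entry B ^~ c)) => //.
      by left.
    have /rowP/(_ c) := qB; rewrite qE birth_row_mul mxE -mulr_sumr => /eqP.
    by rewrite mulf_eq0 (negPf x0) mulr0 => /eqP.
  have /successionP[j1s _ _ _ _] := s0j1.
  by case: Bconst => b c bj; rewrite !B0 //; lia.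
have [i_j|j_i] := boolP ((i == 0%N) || (i < j)%N).
  have sij : is_succession s (i, j).
    by apply/successionP; split=> //; case: (i) i_j.
  have : (i, j) \in successions s by rewrite mem_successions.
  case/(nthP (0, 0)%N) => k ks kE.
  have [tP jts] := essential_closes last_s ks kE.
  have := Bfree k.+1 ks => /(row_free_checkingP _ tP jts) Bk.
  by rewrite qE; apply: Bk; rewrite -?qE.
have [i_gt0 ji] : (0 < i)%N /\ j = i by lia.
subst j; have [fi f0 fsum] := fP.
have fS : f i.+1 = - (i.+1%:R * f 0%N).
  move: fsum; rewrite (@big_nat_recr _ _ _ i.+1) //= (eq_big_nat _ _ (F2 := fun=> f 0%N)).
    by rewrite sumr_const_nat subn0 mulr_natl => /eqP; rewrite addrC addr_eq0 => /eqP.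
  by move=> b /andP[_ bi]; exact: fi.
have [z|nz] := eqVneq (f 0%N) 0.
  rewrite qE; apply: birth_row0 => b; have [bi|] := leqP b i; first by rewrite fi.
  by rewrite leq_eqVlt => /predU1P[<-|/f0 //]; rewrite fS z mulr0 oppr0.
(* the column c has at i+1 the mean of its entries at the births up to i *)
have Bi b c : (b <= i)%N -> birth_entry B b c = birth_entry B i.+1 c.
  move=> bi; apply: (@binary_mean _ i.+1 (birth_entry B ^~ c)) => //.
  have /rowP/(_ c) := qB; rewrite qE birth_row_mul mxE (block_vector_sum _ fP); last by lia.
  rewrite (@big_nat_recr _ _ _ i.+1) //= fS.
  rewrite (eq_big_nat _ _ (F2 := fun b => f 0%N * birth_entry B b c)); last first.
    by move=> a /andP[_ ai]; rewrite fi.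
  rewrite -mulr_sumr mulNr -mulrA mulrCA -mulrBr => /eqP.
  by rewrite mulf_eq0 (negPf nz) subr_eq0 => /eqP.
(* the first run ends before the letter i, which starts a run *)
have j1i : (j1 < i)%N.
  have /successionP[j1s hs1 _ sj1 _] := s0j1.
  rewrite ltnNge; apply/negP => ij1.
  by apply: (si i_gt0); rewrite (hs1 i) ?(hs1 i.-1) //; lia.
by case: Bconst => b c bj; rewrite !Bi //; lia.
Qed.

Unset Implicit Arguments.
Set Strict Implicit.

Theorem mainTheorem3 (R : realType) (s : seq bool) (p : nat)
    (B : 'M[R]_((size s).+1, p))
    (k_ge2 : (2 <= (size s).+1)%N)
    (s_connected : connected_graph (threshold s))
    (B_binary : forall i j, B i j = 0 \/ B i j = 1) :
  controllable (- laplacian R (threshold s)) B <->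
  (forall i : nat, (1 <= i <= size (successions s))%N ->
     row_free ((checking R (essential s i))^T
               *m local_control (essential s i) B)).
Proof.
have last_s := connected_last k_ge2 s_connected.
split=> [/threshold_controllableP AB i|Bfree]; last first.
  by apply/threshold_controllableP; exact: checks_hautus.
case: i => // k /andP[_ ks].
case kE: (nth (0, 0)%N (successions s) k) => [i j].
have [tP jts] := essential_closes last_s ks kE.
have sij : is_succession s (i, j) by rewrite -mem_successions -kE mem_nth.
have /successionP[ijs hs _ _ _] := sij.
apply/(row_free_checkingP _ tP jts) => f fP.
apply: (AB (- (block_eigenvalue s j)%:R)).
by rewrite mulmxN (block_vector_laplacian ijs hs fP) scaleNr.
Qed.
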